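(* Let $\mathbb{F}$ be a field and let $\mathcal{A}$ be an associative finite-dimensional $\mathbb{F}$-algebra with an identity. Then $$l(\mathcal{A})\leq \max\left\{m(\mathcal{A})-1,\ \frac{\dim_{\mathbb{F}}\mathcal{A}}{2}\right\},$$ where $l(\mathcal{A})$ is the length of $\mathcal{A}$ and $m(\mathcal{A})$ is the largest degree of the minimal polynomial over $\mathbb{F}$ of an element of $\mathcal{A}$.
   Context: Let $\mathcal{A}$ be an associative finite-dimensional algebra with identity $1_{\mathcal{A}}$ over a field $\mathbb{F}$. For a finite subset $\mathcal{S}\subset\mathcal{A}$ and $i\ge 0$, $\mathcal{L}_i(\mathcal{S})$ denotes the $\mathbb{F}$-linear span of all products of at most $i$ elements of $\mathcal{S}$ (repetitions allowed), where the empty product is $1_{\mathcal{A}}$; so $\mathcal{L}_0(\mathcal{S})=\mathbb{F}1_{\mathcal{A}}$. Put $\mathcal{L}(\mathcal{S})=\bigcup_{i\ge 0}\mathcal{L}_i(\mathcal{S})$. The set $\mathcal{S}$ is a generating set of $\mathcal{A}$ if $\mathcal{L}(\mathcal{S})=\mathcal{A}$. The length of a generating set $\mathcal{S}$ is $l(\mathcal{S})=\min\{k\in\mathbb{Z}_{\ge 0}:\mathcal{L}_k(\mathcal{S})=\mathcal{A}\}$, and the length of the algebra is $l(\mathcal{A})=\max\{l(\mathcal{S}):\mathcal{L}(\mathcal{S})=\mathcal{A}\}$. For $\tau\in\mathcal{A}$, $m(\tau)$ is the degree of the minimal polynomial of $\tau$ over $\mathbb{F}$, and $m(\mathcal{A})=\max_{\tau\in\mathcal{A}}m(\tau)$.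 *)

(* Defs.v *)
From mathcomp Require Import all_boot all_order all_algebra falgebra.
From mathcomp Require Import finmap boolp.

Set Implicit Arguments.
Unset Strict Implicit.
Unset Printing Implicit Defensive.

Import Order.TTheory GRing.Theory Num.Theory.

Local Open Scope ring_scope.

Section LengthOfGeneratingSets.

Variables (F : fieldType) (A : falgType F).
Implicit Type S : {fset A}.

(* An element of i.-bseq S is a word of at most i letters in S; the empty word
   has product 1. *)
Definition word_span i S : {vspace A} :=
  <<[seq \prod_(s <- w) fsval s | w : i.-bseq S]>>%VS.

Definition generating S : Prop := forall a : A, exists i, a \in word_span i S.

Lemma mem_word_span i S (w : seq S) :
  (size w <= i)%N -> \prod_(s <- w) fsval s \in word_span i S.
Proof.
move=> le_w_i; apply: memv_span; apply/imageP.
by exists (Bseq le_w_i).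
Qed.

Lemma word_span1 i S : 1 \in word_span i S.
Proof. by have := @mem_word_span i S [::] isT; rewrite big_nil. Qed.

Lemma word_span_sub i j S : (i <= j)%N -> (word_span i S <= word_span j S)%VS.
Proof.
move=> le_ij; apply/span_subvP => _ /imageP[w _ ->].
exact/mem_word_span/(leq_trans (size_bseq w)).
Qed.

Lemma word_spanS i S (s : S) a :
  a \in word_span i S -> fsval s * a \in word_span i.+1 S.
Proof.
move=> Sa; have: amull (fsval s) a \in (amull (fsval s) @: word_span i S)%VS.
  exact: memv_img.
rewrite lfunE /=; apply: subvP; rewrite limg_span.
apply/span_subvP => _ /mapP[_ /imageP[w _ ->] ->]; rewrite lfunE /=.
by have /(@mem_word_span i.+1 S (s :: w)) := size_bseq w; rewrite big_cons.
Qed.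

Lemma word_span_stable i j S :
  (word_span i.+1 S <= word_span i S)%VS -> (word_span j S <= word_span i S)%VS.
Proof.
move=> stab; apply/span_subvP => _ /imageP[w _ ->].
elim: (bseqval w) => [|s u IH]; first by rewrite big_nil word_span1.
by rewrite big_cons; apply: (subvP stab); apply: word_spanS.
Qed.

Lemma generating_word_span S :
  generating S -> word_span (\dim {:A}) S == {:A}%VS.
Proof.
move=> genS.
have grow i : word_span i S = {:A}%VS \/ (i < \dim (word_span i S))%N.
  elim: i => [|i [fullS|lt_i]].
  - right; rewrite lt0n dimv_eq0; apply: contraTneq (word_span1 0 S) => ->.
    by rewrite memv0 oner_eq0.
  - by left; apply/eqP; rewrite eqEsubv subvf -fullS word_span_sub.
  have [stab|not_stab] := boolP (word_span i.+1 S <= word_span i S)%VS.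
    left; apply/eqP; rewrite eqEsubv subvf; apply/subvP => a _.
    have [j /(subvP (word_span_stable j stab)) Sa] := genS a.
    exact: (subvP (word_span_sub S (leqnSn i))).
  right; apply: leq_ltn_trans lt_i _; rewrite ltnNge.
  apply: contra not_stab => le_dim.
  by rewrite -(geq_leqif (dimv_leqif_sup (word_span_sub S (leqnSn i)))).
have [->|] := grow (\dim {:A}); first by [].
by rewrite ltnNge dimvS ?subvf.
Qed.

Lemma generating_ex S :
  generating S -> exists k, word_span k S == {:A}%VS.
Proof. by move/generating_word_span; exists (\dim {:A}). Qed.

Definition gen_length S (genS : generating S) : nat :=
  ex_minn (generating_ex genS).

Definition is_gen_length k : Prop :=
  exists S, exists genS : generating S, gen_length genS = k.

Lemma is_gen_length_ex : exists k, `[< is_gen_length k >].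
Proof.
pose S := [fset a in (vbasis {:A} : seq A)]%fset.
suff genS : generating S.
  by exists (gen_length genS); apply/asboolP; exists S, genS.
move=> a; exists 1%N; apply: (subvP _ _ (memvf a)).
rewrite -(span_basis (vbasisP {:A})); apply/span_subvP => b b_basis.
have Sb : b \in S by rewrite inE.
by have := @mem_word_span 1 S [:: [` Sb]%fset] isT; rewrite big_seq1.
Qed.

Lemma is_gen_length_le k : `[< is_gen_length k >] -> (k <= \dim {:A})%N.
Proof.
case/asboolP=> S [genS <-]; rewrite /gen_length.
by case: ex_minnP => l _; apply; apply: generating_word_span.
Qed.

Definition alg_length : nat := ex_maxn is_gen_length_ex is_gen_length_le.

End LengthOfGeneratingSets.

Arguments alg_length {F} A.

Section MinimalPolynomials.

Variables (F : fieldType) (A : falgType F).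
Implicit Types (a : A) (p q : {poly F}).

Lemma annihilator_ex a :
  exists p, [/\ p \is monic, horner_alg a p = 0 & (size p <= (\dim {:A}).+1)%N].
Proof.
pose d : nat := \dim {:A}; pose X := [tuple a ^+ i | i < d.+1].
have not_free : ~ free X.
  move/eqP=> dimX; have := dimvS (subvf <<X>>%VS).
  by rewrite dimX size_tuple ltnn.
have [k] : exists k : 'I_d.+1 -> F,
    ~ (\sum_(i < d.+1) k i *: X`_i = 0 -> forall i, k i = 0).
  by apply/existsNP => indepX; apply/not_free/freeP.
case/not_implyP=> kX /existsNP[i /eqP ki].
pose q := \poly_(j < d.+1) (if insub j is Some j' then k j' else 0).
have q_neq0 : q != 0.
  apply: contraNneq ki => /(congr1 (fun r : {poly F} => r`_i)).
  by rewrite coef_poly ltn_ord valK coef0 => ->.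
have qa : horner_alg a q = 0.
  rewrite -[RHS]kX /q poly_def rmorph_sum /=; apply: eq_bigr => j _.
  rewrite valK linearZ /= rmorphXn /= horner_algX.
  rewrite -[in RHS](tnth_nth 0 X j) tnth_mktuple.
  by rewrite mulr_algl.
have lq_neq0 : (lead_coef q)^-1 != 0 by rewrite invr_eq0 lead_coef_eq0.
exists ((lead_coef q)^-1 *: q); split.
- by rewrite monicE lead_coefZ mulVf ?lead_coef_eq0.
- by rewrite linearZ /= qa mulr0.
by rewrite size_scale // size_poly.
Qed.

Definition is_minpoly a p : Prop :=
  [/\ p \is monic, horner_alg a p = 0 &
      forall q, q \is monic -> horner_alg a q = 0 -> (size p <= size q)%N].

Lemma minpoly_ex a : exists p, is_minpoly a p.
Proof.
pose P n := `[< exists p, [/\ p \is monic, horner_alg a p = 0 & size p = n] >].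
have exP : exists n, P n.
  have [p [p_mon pa _]] := annihilator_ex a.
  by exists (size p); apply/asboolP; exists p.
case: (ex_minnP exP) => n /asboolP[p [p_mon pa <-]] min_p.
exists p; split=> // q q_mon qa; apply/min_p/asboolP.
by exists q.
Qed.

Definition minpoly a : {poly F} := sval (cid (minpoly_ex a)).

Lemma minpolyP a : is_minpoly a (minpoly a).
Proof. exact: svalP (cid (minpoly_ex a)). Qed.

Definition minpoly_deg a : nat := (size (minpoly a)).-1.

Lemma minpoly_deg_le a : (minpoly_deg a <= \dim {:A})%N.
Proof.
have [p [p_mon pa le_p]] := annihilator_ex a.
have [_ _ /(_ p p_mon pa) le_mp] := minpolyP a.
by rewrite /minpoly_deg -subn1 leq_subLR add1n (leq_trans le_mp).
Qed.

Definition is_minpoly_deg k : Prop := exists a : A, minpoly_deg a = k.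

Lemma is_minpoly_deg_ex : exists k, `[< is_minpoly_deg k >].
Proof. by exists (minpoly_deg 0); apply/asboolP; exists 0. Qed.

Lemma is_minpoly_deg_le k : `[< is_minpoly_deg k >] -> (k <= \dim {:A})%N.
Proof. by case/asboolP=> a <-; apply: minpoly_deg_le. Qed.

Definition max_minpoly_deg : nat :=
  ex_maxn is_minpoly_deg_ex is_minpoly_deg_le.

End MinimalPolynomials.

Arguments max_minpoly_deg {F} A.

(* Main.v *)
Require Import Defs.
From mathcomp Require Import all_boot all_order all_algebra falgebra.
From mathcomp Require Import finmap boolp zify.

Import Order.TTheory GRing.Theory Num.Theory.

Local Open Scope ring_scope.

(** Write [L_i] for the span of the words of length at most [i] in a generating
set of length [l], so that [L_i] is the [i]-th power of [V = L_1] and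
[L_0 < L_1 < ... < L_l = A]. If all the jumps [dim L_i - dim L_(i-1)] with
[0 < i < l] are at least 2, then [dim A >= 1 + 2 (l - 1) + 1 = 2 l]. Otherwise
[L_i / L_(i-1)] is a line for some [0 < i < l]. As [V L_i] is not contained in
[L_i], some [s] in [V] maps this line injectively into [L_(i+1) / L_i]. Reading
a word of length [i] from the right, its letters can be replaced one by one
with [s], so the line is spanned by [s^i]. By induction [s^j] spans
[L_j / L_(j-1)] for all [j >= i], so [s^l] is not in [L_(l-1)] and the minimal
polynomial of [s] has degree at least [l + 1]. *)

Lemma subv_add_line (F : fieldType) (vT : vectType F) (U W : {vspace vT}) x :
    (U <= W)%VS -> (\dim W <= (\dim U).+1)%N -> x \in W -> x \notin U ->
  (W <= U + <[x]>)%VS.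
Proof.
move=> sUW dimW Wx U'x.
have sUxW : (U + <[x]> <= W)%VS by rewrite subv_add sUW -memvE.
rewrite -(geq_leqif (dimv_leqif_sup sUxW)); apply: leq_trans dimW _.
rewrite ltnNge (geq_leqif (dimv_leqif_sup (addvSl _ _))).
by apply: contra U'x => /subvP; apply; rewrite memvE addvSr.
Qed.

Section PowersOfSubspace.

Variables (F : fieldType) (A : falgType F) (V : {vspace A}).
Hypothesis V1 : 1 \in V.

Lemma expv_subS n : (V ^+ n <= V ^+ n.+1)%VS.
Proof. by rewrite expvSl -{1}[(V ^+ n)%VS]prod1v prodvSl // -memvE. Qed.

Lemma expv_sub m n : (m <= n)%N -> (V ^+ m <= V ^+ n)%VS.
Proof.
move/subnK <-; elim: (n - m)%N => [|k IH] //.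
exact/(subv_trans IH)/expv_subS.
Qed.

Lemma memv_exp s n : s \in V -> s ^+ n \in (V ^+ n)%VS.
Proof.
move=> Vs; elim: n => [|n IH]; first by rewrite expr0 expv0 memv_line.
by rewrite exprS expvSl memv_mul.
Qed.

Lemma line_quotient_spanned_by_exp j :
    ~~ (V ^+ j.+2 <= V ^+ j.+1)%VS ->
    (\dim (V ^+ j.+1) <= (\dim (V ^+ j)).+1)%N ->
  exists2 s, s \in V & (V ^+ j.+1 <= V ^+ j + <[s ^+ j.+1]>)%VS.
Proof.
move=> ltV dimV.
have [s Vs [w Vw sw]] :
    exists2 s, s \in V & exists2 w, w \in (V ^+ j.+1)%VS &
      s * w \notin (V ^+ j.+1)%VS.
  apply: contrapT => noex; case/negP: ltV; rewrite expvSl.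
  apply/prodvP => s w Vs Vw; apply: contrapT => /negP sw.
  by apply: noex; exists s => //; exists w.
(* Such an [x] spans [V ^+ j.+1] modulo [V ^+ j], so if [s * x] stayed in [V ^+ j.+1], then [s * w]
   would too. *)
have mul_notin x : x \in (V ^+ j.+1)%VS -> x \notin (V ^+ j)%VS ->
    s * x \notin (V ^+ j.+1)%VS.
  move=> Vx V'x; apply: contra sw => sx.
  have /memv_addP[y Vy [_ /vlineP[c ->] ->]] :=
    subvP (subv_add_line _ _ _ _ x (expv_subS j) dimV Vx V'x) w Vw.
  rewrite mulrDr -scalerAr memvD ?memvZ //.
  by rewrite expvSl memv_mul.
have w_notin : w \notin (V ^+ j)%VS.
  by apply: contra sw => Vjw; rewrite expvSl memv_mul.
(* Each step gains a factor [s] on the left, which leaves [V ^+ j.+1], and drops a factor of [V] on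
   the right: if every [s ^+ k.+1 * y] were in [V ^+ j], then [s ^+ k.+1 * x] would be in
   [V ^+ j * V]. *)
have pow k : (k <= j.+1)%N ->
    exists2 x, x \in (V ^+ (j.+1 - k))%VS & s ^+ k * x \notin (V ^+ j)%VS.
  elim: k => [_|k IH lt_kj]; first by exists w; rewrite ?subn0 // mul1r.
  have [x Vx sx] := IH (ltnW lt_kj).
  have Vsx : s ^+ k * x \in (V ^+ j.+1)%VS.
    by rewrite -(subnKC (ltnW lt_kj)) expvD memv_mul ?memv_exp.
  have := mul_notin _ Vsx sx; rewrite mulrA -exprS => ssx.
  apply: contrapT => noex; case/negP: ssx.
  have : s ^+ k.+1 * x \in (<[s ^+ k.+1]> * (V ^+ (j.+1 - k.+1) * V))%VS.
    by rewrite memv_mul ?memv_line // -expvSr subnSK.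
  rewrite prodvA [(V ^+ j.+1)%VS]expvSr; apply/subvP/prodvSl/prodvP.
  move=> _ y /vlineP[c ->] Vy; rewrite -scalerAl memvZ //.
  by apply: contrapT => /negP sy; apply: noex; exists y.
(* At [k = j.+1] the remaining factor lies in [V ^+ 0], hence is a scalar. *)
have [_ /[!subnn] /[!expv0] /vlineP[c ->] sc] := pow _ (leqnn j.+1).
exists s => //; apply: subv_add_line; rewrite ?expv_subS ?memv_exp //.
by apply: contra sc => sj; rewrite -scalerAr mulr1 memvZ.
Qed.

(** The hypothesis is used twice: on the left factor of [v * u], then on [s ^+ j * u] after writing
    [s ^+ j.+1 * u] as [s * (s ^+ j * u)]. *)
Lemma expv_sub_add_exp j s : s \in V ->
    (V ^+ j.+1 <= V ^+ j + <[s ^+ j.+1]>)%VS ->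
  (V ^+ j.+2 <= V ^+ j.+1 + <[s ^+ j.+2]>)%VS.
Proof.
move=> Vs sV; rewrite [(V ^+ j.+2)%VS]expvSr; apply/prodvP => v u Vv Vu.
have /memv_addP[y Vy [_ /vlineP[c ->] ->]] := subvP sV v Vv.
rewrite mulrDl -scalerAl memvD ?memvZ //.
  by apply: (subvP (addvSl _ _)); rewrite expvSr memv_mul.
rewrite exprS -mulrA.
have /(subvP sV)/memv_addP[z Vz [_ /vlineP[d ->] ->]] :
    s ^+ j * u \in (V ^+ j.+1)%VS.
  by rewrite expvSr memv_mul ?memv_exp.
rewrite mulrDr -scalerAr -exprS memv_add ?memvZ ?memv_line //.
by rewrite expvSl memv_mul.
Qed.

(** A monic relation of degree at most [n.+1] would rewrite [s ^+ n.+1] through powers of exponent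
    at most [n], all in [V ^+ n]. *)
Lemma minpoly_deg_gt n s : s \in V -> s ^+ n.+1 \notin (V ^+ n)%VS ->
  (n.+1 < minpoly_deg s)%N.
Proof.
move=> Vs; rewrite ltnNge; apply: contra => le_deg.
have [p_mon pa _] := minpolyP s; set p := minpoly s in p_mon pa.
have p_gt0 : (0 < size p)%N by rewrite size_poly_gt0 monic_neq0.
have sz_p : size p = (minpoly_deg s).+1 by rewrite prednK.
set m := minpoly_deg s in le_deg sz_p.
have sm : s ^+ m = - \sum_(i < m) p`_i *: s ^+ i.
  apply/eqP; rewrite -addr_eq0; apply/eqP; rewrite -[RHS]pa.
  rewrite -[in RHS](coefK p) poly_def sz_p raddf_sum /= big_ord_recr /=.
  have eqX i : horner_alg s (p`_i *: 'X^i) = p`_i *: s ^+ i.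
    by rewrite linearZ /= rmorphXn /= horner_algX mulr_algl.
  rewrite eqX addrC; congr (_ + _).
    by have := monicP p_mon; rewrite /lead_coef sz_p /= => ->; rewrite scale1r.
  by apply: eq_bigr => i _; rewrite eqX.
rewrite -(subnK le_deg) exprD sm mulrN memvN mulr_sumr memv_suml // => i _.
rewrite -scalerAr -exprD memvZ //.
apply: (subvP (expv_sub (n.+1 - m + i) n _)); last exact: memv_exp.
by have := ltn_ord i; lia.
Qed.

Lemma line_quotient_minpoly_deg n j :
    (forall i, (i <= n)%N -> ~~ (V ^+ i.+1 <= V ^+ i)%VS) -> (j < n)%N ->
    (\dim (V ^+ j.+1) <= (\dim (V ^+ j)).+1)%N ->
  exists s : A, (n.+1 < minpoly_deg s)%N.
Proof.
move=> ltV lt_jn dimV.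
have [s Vs sV] := line_quotient_spanned_by_exp j (ltV _ lt_jn) dimV.
have {}sV : (V ^+ n.+1 <= V ^+ n + <[s ^+ n.+1]>)%VS.
  rewrite -(subnK (ltnW lt_jn)); elim: (n - j)%N => // k IH.
  exact: expv_sub_add_exp.
exists s; apply: minpoly_deg_gt => //; apply: contra (ltV n (leqnn n)) => Vsn.
by apply: subv_trans sV _; rewrite subv_add subvv -memvE.
Qed.

Lemma dim_expv_ge n :
    (forall i, (i <= n)%N -> ~~ (V ^+ i.+1 <= V ^+ i)%VS) ->
    (forall i, (i < n)%N -> ((\dim (V ^+ i)).+1 < \dim (V ^+ i.+1))%N) ->
  (n.+1.*2 <= \dim (V ^+ n.+1))%N.
Proof.
move=> ltV jump.
(* The line [V ^+ 0] accounts for strictness; the last jump, only known to be positive, is added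
   afterwards. *)
have : (n.*2 < \dim (V ^+ n))%N.
  elim: {-2}n (leqnn n) => [_|i IH lt_in]; first by rewrite expv0 dimv1.
  by have := jump i lt_in; have := IH (ltnW lt_in); lia.
have := ltV n (leqnn n).
rewrite -(geq_leqif (dimv_leqif_sup (expv_subS n))); lia.
Qed.

End PowersOfSubspace.

(** Since [word_span 1 S] contains 1, its powers also contain the shorter words. *)
Lemma word_span_expv (F : fieldType) (A : falgType F) (S : {fset A}) i :
  word_span i S = (word_span 1 S ^+ i)%VS.
Proof.
elim: i => [|i IH].
  apply/eqP; rewrite expv0 eqEsubv -memvE word_span1 andbT.
  apply/span_subvP => _ /imageP[w _ ->].
  by have := size_bseq w; rewrite leqn0 => /nilP ->; rewrite big_nil memv_line.
apply/eqP; rewrite expvSl -IH eqEsubv; apply/andP; split.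
  apply/span_subvP => _ /imageP[[[|s w] /= le_w] _ ->].
    by rewrite big_nil -[1]mulr1 memv_mul ?word_span1.
  rewrite big_cons memv_mul ?mem_word_span //.
  by have := @mem_word_span _ _ 1 S [:: s] isT; rewrite big_seq1.
apply/prodvP => u v Su Sv.
(* By linearity in [u], it suffices to treat words [u] of at most one letter. *)
have : amulr v u \in (amulr v @: word_span 1 S)%VS by apply: memv_img.
rewrite lfunE /=; apply: subvP; rewrite limg_span.
apply/span_subvP => _ /mapP[_ /imageP[[[|s [|//]] /= le_w] _ ->] ->].
  rewrite lfunE /= big_nil mul1r.
  exact: (subvP (word_span_sub S (leqnSn i))).
by rewrite lfunE /= big_seq1 word_spanS.
Qed.

Lemma gen_length_bound (F : fieldType) (A : falgType F) (S : {fset A})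
    (genS : generating S) :
  (gen_length genS < max_minpoly_deg A)%N \/
  ((gen_length genS).*2 <= \dim {:A})%N.
Proof.
rewrite /gen_length; case: ex_minnP => -[|n] /eqP fullS minS; first by right.
pose V := word_span 1 S; have V1 : 1 \in V := word_span1 1 S.
have ltV i : (i <= n)%N -> ~~ (V ^+ i.+1 <= V ^+ i)%VS.
  (* A stall at [i <= n] would already give the whole algebra, against the minimality of [n.+1]. *)
  move=> le_in; apply/negP; rewrite -!word_span_expv.
  move/(word_span_stable n.+1); rewrite fullS => full_i.
  have /minS : word_span i S == {:A}%VS by rewrite eqEsubv subvf.
  by rewrite ltnNge le_in.
have [[j lt_jn dimV] | jump] :=
    pselect (exists2 j, (j < n)%N & (\dim (V ^+ j.+1) <= (\dim (V ^+ j)).+1)%N).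
  left; have [s lt_s] := line_quotient_minpoly_deg _ _ _ V1 n j ltV lt_jn dimV.
  rewrite /max_minpoly_deg; case: ex_maxnP => m _ max_m.
  by apply/(leq_trans lt_s)/max_m/asboolP; exists s.
right; rewrite -fullS word_span_expv; apply: dim_expv_ge => // i lt_in.
by rewrite ltnNge; apply/negP => dimV; apply: jump; exists i.
Qed.

Theorem theorem3p5 (F : fieldType) (A : falgType F) :
  (alg_length A)%:R <=
    Num.max ((max_minpoly_deg A)%:R - 1) ((\dim {:A})%:R / 2) :> rat.
Proof.
rewrite /alg_length; case: ex_maxnP => _ /asboolP[S [genS <-]] _.
rewrite le_max lerBrDr.
have [lt_m | le_dim] := gen_length_bound _ _ _ genS; apply/orP; [left|right].
  by rewrite natr1 ler_nat.
by rewrite ler_pdivlMr // -natrM ler_nat muln2.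
Qed.
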